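(* Let $N\ge 1$ be an integer, let $L,R>0$ and $\gamma\in(0,L\sqrt N)$. Consider the classical subgradient method with constant step sizes $h_k=\frac{R}{L\sqrt{N+1}}$ for $k=0,\dots,N$. There exists a problem instance (a space $X$, an initial point $x_0\in X$, a function $f\in\mathcal F$, subgradients $g_k\in\partial f(x_k)$ and errors $e_0,\dots,e_{N-1}$ with $\sum_{k=0}^{N-1}\|e_k\|^2\le\gamma^2$) for which the output $x_{N+1}$ of the method satisfies $$f(x_{N+1})-f_\star\ \ge\ \frac{\gamma^2R}{8L\sqrt{N+1}}.$$ This lower bound exceeds the trivial bound $RL$ when $\gamma>2\sqrt2\,(N+1)^{1/4}L$, and (for fixed $L,R$) it grows unbounded as $N\to\infty$ when $\gamma=\gamma_N\gg N^{1/4}$.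
   Context: $X$ is a real Hilbert space with inner product $\langle\cdot,\cdot\rangle$ and norm $\|\cdot\|$. Given $x_0\in X$, $\mathcal F$ is the class of convex functions $f:X\to\mathbb R$ such that every subgradient $g\in\partial f(x)$, $x\in X$, satisfies $\|g\|\le L$, and such that $f$ attains its minimum $f_\star=f(x_\star)$ at some $x_\star$ with $\|x_\star-x_0\|\le R$. The subgradient method with adversarially corrupted subgradients and step sizes $h_0,\dots,h_N$ produces $$x_{k+1}=x_k-h_k\tilde g_k,\quad \tilde g_k=g_k+e_k,\quad g_k\in\partial f(x_k),\quad k=0,\dots,N-1,\qquad x_{N+1}=\frac{\sum_{k=0}^N h_kx_k}{\sum_{k=0}^N h_k},$$ where the adversary chooses the errors $e_k$ subject to $\sum_{k=0}^{N-1}\|e_k\|^2\le\gamma^2$. The notation $a_N\gg b_N$ means $b_N/a_N\to0$ as $N\to\infty$. *)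

(* Defs.v *)
From HB Require Import structures.
From mathcomp Require Import all_boot all_order all_algebra.
From mathcomp Require Import all_classical all_reals all_analysis.

Set Implicit Arguments.
Unset Strict Implicit.
Unset Printing Implicit Defensive.

Import Order.TTheory GRing.Theory Num.Theory.
Import numFieldNormedType.Exports.

Local Open Scope classical_set_scope.
Local Open Scope ring_scope.

(* Completeness comes from the carrier; the last field makes its norm (hence
   its topology) the one induced by the inner product. *)
Record hilbertSpace (K : realType) := HilbertSpace {
  hilbert_sort :> completeNormedModType K;
  inner : {dot hilbert_sort for idfun};
  hilbert_normE : forall x : hilbert_sort, `|x| = Num.sqrt (inner x x) }.

Section SubgradientMethod.
Context {K : realType} {X : hilbertSpace K}.
Implicit Types (f : X -> K) (x g e : nat -> X).

Definition subdifferential f (a : X) : set X :=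
  [set v | forall y : X, f a + inner X v (y - a) <= f y].

Definition minimizer f (a : X) : Prop := forall y : X, f a <= f y.

Definition function_class (L R : K) (x0 : X) : set (X -> K) :=
  [set f | [/\ @convex_function K X setT f,
               forall a v : X, subdifferential f a v -> `|v| <= L
             & exists2 xstar : X, minimizer f xstar & `|xstar - x0| <= R]].

(* The iterates are [x 0], ..., [x N] and the output is [x N.+1]; only the
   values of [g] and [e] at indices [k < N] matter. *)
Definition subgradient_run f (h : nat -> K) (N : nat) (x0 : X) g e x : Prop :=
  [/\ x 0%N = x0,
      forall k, (k < N)%N -> subdifferential f (x k) (g k),
      forall k, (k < N)%N -> x k.+1 = x k - h k *: (g k + e k)
    & x N.+1 = (\sum_(k < N.+1) h k)^-1 *: \sum_(k < N.+1) h k *: x k].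

End SubgradientMethod.

(* Intended for sequences [a] that do not vanish, since [_ / 0 = 0]. *)
Definition much_larger {K : realType} (a b : nat -> K) : Prop :=
  b N / a N @[N --> \oo] --> (0 : K).

(* Main.v *)
Require Import Defs.
From HB Require Import structures.
From mathcomp Require Import all_boot all_order all_algebra.
From mathcomp Require Import all_classical all_reals all_analysis.
From mathcomp Require Import ring lra.

Set Implicit Arguments.
Unset Strict Implicit.
Unset Printing Implicit Defensive.

Import Order.TTheory GRing.Theory Num.Theory.
Import numFieldNormedType.Exports.

Local Open Scope classical_set_scope.
Local Open Scope ring_scope.

(** The lower bound is already attained on the real line, by the function
    [s * `|x|] started at its own minimizer [x0 = 0].  The subgradient [s]
    is valid at every point of the half-line [x >= 0], and the error [- 2 s]
    turns it into [- s], so that the method climbs the function instead of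
    descending it: [x k = k * h * s].  The average of the iterates
    is [N * h * s / 2], where the function takes the value [N * h * s ^ 2 / 2].
    The errors cost [N * (2 s) ^ 2], so the slope that exhausts the budget is
    [s = gamma / (2 sqrt N)]; the value is then [gamma ^ 2 * h / 8], which is
    the announced bound for [h = R / (L * sqrt (N + 1))].  The assumption on
    [gamma] keeps the slope below [L].

    The two comparisons on the size of the bound come from
    [(N ^ (1/4)) ^ 2 = sqrt N]: squaring a comparison of [gamma] with a
    multiple of [N ^ (1/4)] gives one of [gamma ^ 2] with a multiple
    of [sqrt N]. *)

(** * The real line as a Hilbert space *)

Section RealLine.
Context {K : realType}.

Definition mul_inner (x y : K^o) : K := x * y.

Let mul_inner_additivel y : zmod_morphism (mul_inner^~ y).
Proof. by move=> a b; rewrite /mul_inner mulrBl. Qed.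

Let mul_inner_additiver x : zmod_morphism (mul_inner x).
Proof. by move=> a b; rewrite /mul_inner mulrBr. Qed.

Let mul_inner_scalablel y : scalable_for *%R (mul_inner^~ y).
Proof. by move=> a b; rewrite /mul_inner -mulrA. Qed.

Let mul_inner_scalabler x : scalable_for (idfun \; *%R) (mul_inner x).
Proof. by move=> a b; rewrite /mul_inner /= mulrCA. Qed.

HB.instance Definition _ := isBilinear.Build K K^o K^o K *%R (idfun \; *%R)
  mul_inner mul_inner_additivel mul_inner_additiver
  mul_inner_scalablel mul_inner_scalabler.

Let mul_inner_sym (x y : K^o) :
  mul_inner x y = (-1) ^+ false * idfun (mul_inner y x).
Proof. by rewrite /mul_inner /= expr0 mul1r mulrC. Qed.

HB.instance Definition _ :=
  isHermitianSesquilinear.Build K K^o false idfun mul_inner mul_inner_sym.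

Let mul_inner_gt0 (x : K^o) : x != 0 -> 0 < mul_inner x x.
Proof. by move=> x0; rewrite /mul_inner -expr2 exprn_even_gt0. Qed.

HB.instance Definition _ := isDotProduct.Build K K^o mul_inner mul_inner_gt0.

Let mul_inner_norm (x : K^o) : `|x| = Num.sqrt (mul_inner x x).
Proof. by rewrite /mul_inner -expr2 sqrtr_sqr. Qed.

Definition realLine : hilbertSpace K :=
  @HilbertSpace K K^o mul_inner mul_inner_norm.

End RealLine.

(** * Multiples of the norm *)

Section ScaledNorm.
Context {K : realType} {X : hilbertSpace K}.
Implicit Types (s L R : K).

Lemma convex_scaled_norm s :
  0 <= s -> @convex_function K X setT (fun x : X => s * `|x|).
Proof.
move=> s0 t x y _ _.
have t0 : 0 <= t%:num by [].
have t1 : 0 <= 1 - t%:num by rewrite subr_ge0.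
have -> : conv t (s * `|x| : K^o) (s * `|y| : K^o)
        = s * (t%:num * `|x| + (1 - t%:num) * `|y|).
  by rewrite convRE; set u := t%:num; rewrite -[X in _ + X * _]/(1 - u); ring.
apply: ler_wpM2l => //.
apply: le_trans (ler_normD _ _) _.
by rewrite !normrZ (ger0_norm t0) (ger0_norm t1).
Qed.

(** Testing the subgradient inequality at [a + v] bounds [`|v| ^+ 2] by an
    increment of the function, which is at most [s * `|v|]. *)
Lemma subdifferential_lipschitz (f : X -> K) s (a v : X) :
  0 <= s -> (forall x y : X, f x - f y <= s * `|x - y|) ->
  subdifferential f a v -> `|v| <= s.
Proof.
move=> s0 lipf sub_v.
have [->|v0] := eqVneq v 0; first by rewrite normr0.
have v_gt0 : 0 < `|v| by rewrite normr_gt0.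
have := lipf (a + v) a; have := sub_v (a + v).
rewrite [a + v - a]addrC addKr => h1 h2.
rewrite -(ler_pM2r v_gt0).
have <- : inner X v v = `|v| * `|v|.
  rewrite -expr2 [in RHS]hilbert_normE sqr_sqrtr // ltW //.
  exact: neq0_dnorm_gt0.
lra.
Qed.

Lemma scaled_norm_class s L R (x0 : X) :
  0 <= s <= L -> `|x0| <= R ->
  function_class L R x0 (fun x : X => s * `|x|).
Proof.
move=> /andP[s0 sL] x0R; split; first exact: convex_scaled_norm.
- move=> a v /subdifferential_lipschitz; move/(_ s s0) => H.
  apply: le_trans (H _) sL => x y.
  by rewrite -mulrBr ler_wpM2l // lerB_dist.
- exists 0; last by rewrite add0r normrN.
  by move=> y /=; rewrite normr0 mulr0 mulr_ge0.
Qed.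

End ScaledNorm.

Lemma realLine_subgradient (K : realType) (s : K) (a : @realLine K) :
  0 <= s -> 0 <= (a : K) ->
  subdifferential (fun x : @realLine K => s * `|x|) a s.
Proof.
move=> s0 a0 y /=.
rewrite (ger0_norm a0) /inner /= /mul_inner -mulrDr ler_wpM2l //.
by rewrite addrC subrK ler_norm.
Qed.

(** * The climbing run *)

Lemma sum_scale_natr (K : realType) (V : lmodType K) (v : V) n :
  \sum_(k < n.+1) (k%:R : K) *: v = (n%:R * n.+1%:R / 2 : K) *: v.
Proof.
rewrite -scaler_suml; congr (_ *: _).
elim: n => [|n IHn]; first by rewrite big_ord1 mul0r mul0r.
by rewrite big_ord_recr IHn /= -(natr1 n.+1) -(natr1 n); field.
Qed.

(** With equal weights, an output on a uniformly drifting run sits halfway. *)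
Lemma average_drift (K : realType) (V : lmodType K) (v : V) (h : K) n :
  h != 0 ->
  (\sum_(k < n.+1) h)^-1 *: \sum_(k < n.+1) h *: ((k%:R : K) *: v)
  = (n%:R / 2 : K) *: v.
Proof.
move=> h0; rewrite -scaler_sumr sum_scale_natr !scalerA; congr (_ *: _).
rewrite sumr_const card_ord -mulr_natr.
have n0 : n.+1%:R != 0 :> K by rewrite pnatr_eq0.
by field; rewrite h0 addrC natr1 n0.
Qed.

(** The error [- 2 s] reverses the subgradient [s], so every step moves up by
    [h * s].  The point of index [N.+1] is the average of the others, not one
    more step, hence the case distinction. *)
Lemma climbing_run (K : realType) (s h : K) (N : nat) :
  0 <= s -> 0 < h ->
  @subgradient_run K realLine (fun x => s * `|x|) (fun=> h) N 0
    (fun=> s) (fun=> - (2 * s))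
    (fun k => if (k <= N)%N then k%:R * (h * s) else N%:R / 2 * (h * s)).
Proof.
move=> s0 h0; split => [|k kN|k kN|].
- by rewrite mul0r.
- by apply: realLine_subgradient; rewrite ?(ltnW kN) // !mulr_ge0 // ltW.
- rewrite kN (ltnW kN) -natr1 /GRing.scale /=; ring.
- rewrite ltnn; transitivity ((N%:R / 2 : K) *: (h * s : K^o)) => //.
  rewrite -(average_drift _ _ (lt0r_neq0 h0)); congr (_ *: _).
  by apply: eq_bigr => k _; rewrite -ltnS ltn_ord.
Qed.

(** * Size of the bound *)

Lemma sqr_powR4 (K : realType) (a : K) :
  0 <= a -> (a `^ 4^-1) ^+ 2 = Num.sqrt a.
Proof.
move=> a0; rewrite -powR_mulrn ?powR_ge0 // -powRrM -powR12_sqrt //.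
by congr powR; field.
Qed.

Lemma trivial_bound_lt (K : realType) (L R gamma a : K) :
  0 < L -> 0 < R -> 0 < a -> 2 * Num.sqrt 2 * a `^ 4^-1 * L < gamma ->
  R * L < gamma ^+ 2 * R / (8 * L * Num.sqrt a).
Proof.
move=> L0 R0 a0 hg.
have sa0 : 0 < Num.sqrt a by rewrite sqrtr_gt0.
rewrite ltr_pdivlMr ?mulr_gt0 //.
have b0 : 0 <= 2 * Num.sqrt 2 * a `^ 4^-1 * L.
  by rewrite !mulr_ge0 ?powR_ge0 ?sqrtr_ge0 // ltW.
have : (2 * Num.sqrt 2 * a `^ 4^-1 * L) ^+ 2 < gamma ^+ 2.
  by rewrite ltr_pXn2r // nnegrE // (le_trans b0 (ltW hg)).
rewrite !exprMn sqr_powR4 ?(ltW a0) // sqr_sqrtr // -(ltr_pM2l R0).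
by congr (_ < _); ring.
Qed.

(** Squaring the hypothesis gives [sqrt N <= (eps * gamma) ^ 2], and
    [sqrt (N + 1) <= 2 sqrt N] for [N >= 1]: hence 16 instead of 8. *)
Lemma lower_bound_ge (K : realType) (L R gamma eps : K) (N : nat) :
  0 < L -> 0 < R -> 0 < eps -> (1 <= N)%N ->
  N%:R `^ 4^-1 <= eps * gamma ->
  R / (16 * L * eps ^+ 2) <= gamma ^+ 2 * R / (8 * L * Num.sqrt N.+1%:R).
Proof.
move=> L0 R0 e0 N1 hN.
have sN0 : 0 < Num.sqrt (N.+1%:R : K) by rewrite sqrtr_gt0 ltr0n.
have sNS : Num.sqrt N.+1%:R <= 2 * Num.sqrt N%:R :> K.
  have -> : 2 * Num.sqrt N%:R = Num.sqrt (4 * N%:R) :> K.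
    rewrite sqrtrM //; congr (_ * _).
    by rewrite (_ : 4 = 2 ^+ 2) ?sqrtr_sqr ?ger0_norm //; ring.
  rewrite ler_wsqrtr // -natrM ler_nat -(addn1 N) mulSn leq_add2l.
  by rewrite (leq_trans N1) // leq_pmull.
have hsq : Num.sqrt N%:R <= (eps * gamma) ^+ 2.
  rewrite -sqr_powR4 // ler_pXn2r // nnegrE ?powR_ge0 //.
  exact: le_trans (powR_ge0 _ _) hN.
rewrite ler_pdivrMr ?mulr_gt0 ?exprn_gt0 // mulrAC ler_pdivlMr ?mulr_gt0 //.
have := le_trans sNS (ler_wpM2l (ler0n _ 2) hsq).
rewrite -(ler_pM2l (_ : 0 < 8 * L * R)) ?mulr_gt0 //.
by congr (_ <= _); ring.
Qed.

(** * Attaining the bound *)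

Theorem lemma1 (K : realType) (L R : K) (hL : 0 < L) (hR : 0 < R) :
  (forall (N : nat) (gamma : K),
     (1 <= N)%N -> 0 < gamma -> gamma < L * Num.sqrt N%:R ->
     (exists (X : hilbertSpace K) (x0 : X) (f : X -> K) (g e x : nat -> X),
        [/\ function_class L R x0 f,
            subgradient_run f (fun=> R / (L * Num.sqrt N.+1%:R)) N x0 g e x,
            \sum_(k < N) `|e k| ^+ 2 <= gamma ^+ 2
          & forall xstar : X, minimizer f xstar ->
              f (x N.+1) - f xstar
                >= gamma ^+ 2 * R / (8 * L * Num.sqrt N.+1%:R)])
     /\ (2 * Num.sqrt 2 * N.+1%:R `^ (4^-1) * L < gamma ->
         R * L < gamma ^+ 2 * R / (8 * L * Num.sqrt N.+1%:R)))
  /\ (forall gamma : nat -> K,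
        (forall N : nat, (1 <= N)%N ->
           0 < gamma N /\ gamma N < L * Num.sqrt N%:R) ->
        much_larger gamma (fun N => N%:R `^ (4^-1)) ->
        gamma N ^+ 2 * R / (8 * L * Num.sqrt N.+1%:R) @[N --> \oo] --> +oo).
Proof.
split => [N gamma N1 g0 gL|gamma hgamma].
  split; last by apply: trivial_bound_lt => //; rewrite ltr0n.
  set h := R / _.
  have N0 : 0 < (N%:R : K) by rewrite ltr0n.
  have sN0 : 0 < Num.sqrt (N%:R : K) by rewrite sqrtr_gt0.
  have sNS0 : 0 < Num.sqrt (N.+1%:R : K) by rewrite sqrtr_gt0 ltr0n.
  have h0 : 0 < h by rewrite divr_gt0 ?mulr_gt0.
  (* The slope for which the errors [- 2 s] use the whole budget. *)
  pose s := gamma / (2 * Num.sqrt N%:R).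
  have s0 : 0 < s by rewrite divr_gt0 ?mulr_gt0.
  have sL : s <= L.
    by rewrite ler_pdivrMr ?mulr_gt0 //; have := mulr_gt0 hL sN0; nra.
  have s2 : N%:R * (2 * s) ^+ 2 = gamma ^+ 2.
    rewrite /s -[X in X * _](sqr_sqrtr (ltW N0)); field.
    exact: lt0r_neq0.
  exists realLine, 0, (fun x => s * `|x|).
  do 3 eexists; split.
  - apply: scaled_norm_class; last by rewrite normr0 ltW.
    by rewrite (ltW s0).
  - exact: climbing_run (ltW s0) h0.
  - rewrite sumr_const card_ord normrN real_normK ?num_real //.
    by rewrite -[leLHS]mulr_natl s2.
  - move=> xstar /(_ 0); rewrite normr0 mulr0 => fx0.
    have x_ge0 : 0 <= N%:R / 2 * (h * s).
      by exact: mulr_ge0 (divr_ge0 _ _) (ltW (mulr_gt0 h0 s0)).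
    rewrite ltnn (ger0_norm x_ge0).
    have -> : gamma ^+ 2 * R / (8 * L * Num.sqrt N.+1%:R)
            = s * (N%:R / 2 * (h * s)).
      by rewrite -s2 /h; field; rewrite !lt0r_neq0.
    by rewrite lerBrDl; lra.
move=> hlim; apply/cvgryPge => A.
(* Chosen so that [R / (16 * L * eps ^+ 2)] equals [`|A| + 1]. *)
pose eps := Num.sqrt (R / (16 * L * (`|A| + 1))).
have A0 : 0 < `|A| + 1 by rewrite ltr_wpDl.
have e0 : 0 < eps by rewrite sqrtr_gt0 divr_gt0 ?mulr_gt0.
move/cvgrPdist_lt : hlim => /(_ _ e0) hlim.
near=> N.
have N1 : (1 <= N)%N by near: N; exists 1%N.
have [g0 _] := hgamma N N1.
have hN : N%:R `^ 4^-1 <= eps * gamma N.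
  rewrite -ler_pdivrMr // ltW //.
  have : `|0 - N%:R `^ 4^-1 / gamma N| < eps by near: N.
  by rewrite sub0r normrN ger0_norm // divr_ge0 ?powR_ge0 ?ltW.
apply: le_trans (lower_bound_ge hL hR e0 N1 hN).
rewrite sqr_sqrtr; last by rewrite divr_ge0 ?mulr_ge0 ?ltW.
have -> : R / (16 * L * (R / (16 * L * (`|A| + 1)))) = `|A| + 1.
  by field; rewrite !lt0r_neq0.
by have := ler_norm A; lra.
Unshelve. all: by end_near.
Qed.
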